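(* Let $b \in \{2,3,4,\ldots\}$, let $c$ be a real root of an integer (i.e. $c^j \in \mathbb{Z}$ for some integer $j \geq 1$), and let $u>1$ be a real number such that there exist integers $h \geq 1$, $\ell$, a number $\hat c$, and four Laurent polynomials $p_1,p_2,p_3,p_4$ in a variable $x$ with integer coefficients and only finitely many nonzero coefficients, satisfying: \begin{enumerate} \item $p_1(u) = \sum_{k \in \mathbb Z} b_k u^k = 1/b$; \item $p_2(u) = \sum_{k \in \mathbb Z} c_k u^k = c$; \item $p_3(u) = \sum_{k=0,-1,\ldots,-h+1} d_k u^k = 0$ with $d_0=1$; \item $p_4(u) = \sum_{k \in \mathbb Z} e_k u^k = 0$ with $e_\ell > \sum_{k \neq \ell} |e_k|$. \end{enumerate} Assume furthermore that $\hat c > 3|e_\ell|$ and that for every Laurent polynomial $p = \sum_{k=-m}^{n} a_k x^k$ with integer coefficients satisfying $|a_k| \leq 3|e_\ell|$ for all $k$, the following algorithm $C$ satisfies the termination condition below. Algorithm $C$: set $k = n+h$ (with $a_{k'}=0$ for $k'>n$ and $k'<-m$); while $k > -m$ and $|a_{k'}| \leq \hat c$ for all $k' \in \{k,k-1,\ldots,k-h+1\}$, replace $p$ by $p - a_k \cdot p_3(x)\cdot x^k$ (updating the coefficients $a_{k'}$ of $p$ accordingly) and then set $k=k-1$. Termination condition: whenever $C$ stops at some $k > -m$ with some $|a_{k'}| > \hat c$ for some $k' \in \{k,\ldots,k-h+1\}$, then $$\Big|\sum_{k'=k,k-1,\ldots,k-h+1} u^{k'} a_{k'}\Big| > \frac{u^{k-h}}{1-u^{-1}}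 \cdot 3|e_\ell|.$$ Then, with $$S = \Big\{\sum_{k=-m}^{n} a_k u^k : m,n \in \mathbb N,\ a_k \in \mathbb Z,\ |a_k| < |e_\ell|\Big\}$$ (each element given as the word $k \mapsto a_k$ on $\{-m,\ldots,n\}$ and interpreted as the real number $\sum_k a_k u^k$), every member of $\mathbb{D}_b[c]$ is represented by some element of $S$, and the structure $(S,+,<,=;\cdot)$ has automatic addition and automatic comparisons $<,=$ and semiautomatic multiplication. Moreover, it is a dense subset of the reals and so forms a semiautomatic grid.
   Context: $\mathbb{D}_b = \{n/b^m : n,m \in \mathbb Z\}$ and $\mathbb{D}_b[c]$ is the subring of $\mathbb R$ generated by $\mathbb D_b$ and $c$. Words are functions from a finite subset (here an interval) of $\mathbb Z$ to a finite alphabet $\Sigma$. The convolution of words $w_1,\ldots,w_r$ is the word on $\bigcup_i dom(w_i)$ whose symbol at position $h$ is the tuple $(w_1'(h),\ldots,w_r'(h))$, where $w_i'(h)=w_i(h)$ if defined and $w_i'(h)=\#$ (a new padding symbol) otherwise. A relation $R$ on represented elements is automatic iff the set of convolutions of tuples of words whose represented values are in $R$ is regular (recognised by a finite automaton); a function $f$ is automatic iff the set of convolutions of $(x_1,\ldots,x_r,y)$ with $f(x_1,\ldots,x_r)=y$ (on represented values) is regular. A binary function such as multiplication is semiautomatic iff for every fixed value of one argument, the resulting unary function of the other argument is automatic. In the structure $(S,+,<,=;\cdot)$, the operations before the semicolon are required to be automatic and those after the semicolon only semiautomatic. A semiautomatic grid is such a semiautomatic ring $(A,+,=,<;\cdot)$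 whose elements represent real numbers forming a dense subring of $\mathbb R$. *)

(* Defs.v *)
From HB Require Import structures.
From mathcomp Require Import all_boot all_order all_algebra.
From mathcomp Require Import reals.
Set Implicit Arguments. Unset Strict Implicit. Unset Printing Implicit Defensive.
Import Order.TTheory GRing.Theory Num.Theory.
Local Open Scope ring_scope.

Section Defs.
Variable R : realType.

(* A Laurent polynomial is a coefficient function f : int -> int whose
   support is contained in [-N, N]. *)
Definition lsupp (f : int -> int) (N : nat) : Prop :=
  forall k : int, (N < `|k|)%N -> f k = 0.

Definition leval (u : R) (f : int -> int) (N : nat) : R :=
  \sum_(i < (N + N).+1) (f (i%:Z - N%:Z))%:~R * u ^ (i%:Z - N%:Z).

Definition labs_others (f : int -> int) (N : nat) (l : int) : int :=
  \sum_(i < (N + N).+1 | i%:Z - N%:Z != l) `|f (i%:Z - N%:Z)|.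

Definition window_ok (h : nat) (chat : R) (a : int -> int) (k : int) : bool :=
  all (fun i : nat => (`|a (k - i%:Z)|)%:~R <= chat) (iota 0 h).

(* p := p - a_k * p3(x) * x^k, where p3 has coefficient function d *)
Definition stepC (d : int -> int) (a : int -> int) (k : int) : int -> int :=
  fun j => a j - a k * d (j - k).

Fixpoint runC (d : int -> int) (h : nat) (chat : R) (m : nat) (fuel : nat)
  (a : int -> int) (k : int) : (int -> int) * int :=
  match fuel with
  | 0%N => (a, k)
  | f.+1 => if (- (m%:Z) < k) && window_ok h chat a k
            then runC d h chat m f (stepC d a k) (k - 1)
            else (a, k)
  end.

(* A word (m, s) has domain {-m, ..., n} where n = size s - m - 1; the
   symbol at position -m + i is the i-th entry of s. *)
Definition word := (nat * seq int)%type.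

Definition wlo (w : word) : nat := w.1.
Definition whi (w : word) : nat := (size w.2 - w.1 - 1)%N.

Definition wval (u : R) (w : word) : R :=
  \sum_(i < size w.2) (nth 0 w.2 i)%:~R * u ^ (i%:Z - (w.1)%:Z).

(* membership in S: nonempty domain {-m..n} (m,n in N) and digits |a_k| < E *)
Definition inS (E : int) (w : word) : bool :=
  (w.1 < size w.2)%N && all (fun a => `|a| < E) w.2.

(* the symbol of w at position k, or None (the padding symbol #) *)
Definition digit_at (w : word) (k : int) : option int :=
  if (- (wlo w)%:Z <= k) && (k <= (whi w)%:Z)
  then Some (nth 0 w.2 (absz (k + (wlo w)%:Z))) else None.

(* Convolution of words ws, read from the lowest position -M to the highest
   position N of the union of the domains; each letter is the tuple of
   symbols (with padding None) together with a flag marking position 0. *)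
Definition conv (ws : seq word) : seq (seq (option int) * bool) :=
  let M := \max_(w <- ws) wlo w in
  let N := \max_(w <- ws) whi w in
  [seq ([seq digit_at w (i%:Z - M%:Z) | w <- ws], (i%:Z - M%:Z) == 0)
  | i <- iota 0 (M + N).+1].

Definition regular (A : eqType) (L : seq A -> Prop) : Prop :=
  exists (Q : finType) (q0 : Q) (delta : Q -> A -> Q) (F : pred Q),
    forall s, L s <-> F (foldl delta q0 s).

Definition Sval (E : int) (u : R) (x : R) : Prop :=
  exists w, inS E w /\ wval u w = x.

Definition Dset (b : nat) (x : R) : Prop :=
  exists n m : int, x = n%:~R / (b%:R) ^ m.

(* subring of R generated by D_b and c *)
Definition Dbc (b : nat) (c : R) (x : R) : Prop :=
  forall P : R -> Prop,
    P 1 -> (forall y z, P y -> P z -> P (y - z)) ->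
    (forall y z, P y -> P z -> P (y * z)) ->
    (forall y, Dset b y -> P y) -> P c -> P x.

Definition automatic_add (E : int) (u : R) : Prop :=
  (forall x y, inS E x -> inS E y ->
     exists z, inS E z /\ wval u z = wval u x + wval u y) /\
  regular (fun s => exists x y z, [/\ inS E x, inS E y, inS E z,
             wval u x + wval u y = wval u z & s = conv [:: x; y; z]]).

Definition automatic_lt (E : int) (u : R) : Prop :=
  regular (fun s => exists x y, [/\ inS E x, inS E y,
             wval u x < wval u y & s = conv [:: x; y]]).

Definition automatic_eq (E : int) (u : R) : Prop :=
  regular (fun s => exists x y, [/\ inS E x, inS E y,
             wval u x = wval u y & s = conv [:: x; y]]).

Definition semiautomatic_mul (E : int) (u : R) : Prop :=
  (forall x y, inS E x -> inS E y ->
     exists z, inS E z /\ wval u z = wval u x * wval u y) /\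
  (forall w, inS E w ->
     regular (fun s => exists x y, [/\ inS E x, inS E y,
             wval u w * wval u x = wval u y & s = conv [:: x; y]]) /\
     regular (fun s => exists x y, [/\ inS E x, inS E y,
             wval u x * wval u w = wval u y & s = conv [:: x; y]])).

Definition dense_subring (P : R -> Prop) : Prop :=
  [/\ P 1, (forall x y, P x -> P y -> P (x - y)),
      (forall x y, P x -> P y -> P (x * y)) &
      (forall x y, x < y -> exists z, P z /\ x < z /\ z < y)].

End Defs.

(* Main.v *)
Require Import Defs.
From HB Require Import structures.
From mathcomp Require Import all_boot all_order all_algebra.
From mathcomp Require Import boolp reals.
From mathcomp Require Import zify ring lra.
Import Order.TTheory GRing.Theory Num.Theory.
Local Open Scope ring_scope.
Set Implicit Arguments. Unset Strict Implicit. Unset Printing Implicit Defensive.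

(* Let [E = |e_l|], and for a bound [B] let [X_B] be the set of the sums
   [\sum_(k >= 0) a_k u^k] with integer digits [|a_k| <= B].

   Subtracting shifted copies of [p_4] rewrites any integer Laurent polynomial
   in [u] with digits smaller than [E], so [S] represents exactly [Z[u, 1/u]],
   a dense ring containing [1/b] and [c].

   Reading digits from the highest position down, Horner's rule replaces the
   current value [r] by [u r + a]. Once [|r| > B / (u - 1)], this remains so and
   the sign of [r] is final. Hence a linear relation between words is decided by
   a finite automaton as soon as [X_B] meets every bounded interval in a finite
   set, the remembered state being either [r] or its final sign.

   For [B = 3E] and the interval [|r| <= B / (u - 1)] this finiteness is what the
   hypothesis on algorithm C gives: a value in the interval never overflows, so it
   is determined by a bounded window of [h] coefficients. If [z] in [S] represents
   the sum of [x, y] in [X_(E-1)], the part of [x + y - z] at positions [>= 0] lies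
   in this finite set, so [z] can be chosen with a fractional part of bounded
   length [K]. Thus [X_(E-1) + X_(E-1)] is contained in [u^-K X_(E-1)], and the
   finiteness follows for every [B]. Since it is also stable under multiplication
   by elements of [Z[u, 1/u]], the same automata decide [w x = y] for a fixed [w]. *)

(** * Values of digit sequences and the sets [X_B] *)

Section DigitSums.
Variables (R : realType) (u : R).
Implicit Types (s t : seq int) (x y : R).

(** Lists start at the lowest position, so [foldr] is Horner's rule from the highest digit down. *)
Definition hval (s : seq R) : R := foldr (fun a r => a + u * r) 0 s.

Definition ival s : R := hval [seq a%:~R | a <- s].

Lemma hval_cat (s t : seq R) : hval (s ++ t) = hval s + u ^+ size s * hval t.
Proof.
elim: s => [|a s IH] /=; first by rewrite expr0; ring.
by rewrite IH exprS; ring.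
Qed.

Lemma ival_cons a s : ival (a :: s) = a%:~R + u * ival s.
Proof. by []. Qed.

Lemma ival_cat s t : ival (s ++ t) = ival s + u ^+ size s * ival t.
Proof. by rewrite /ival map_cat hval_cat size_map. Qed.

Lemma ival_nseq0 n : ival (nseq n 0) = 0.
Proof. by elim: n => //= n IH; rewrite ival_cons IH; ring. Qed.

Lemma hval_sum (s : seq R) : hval s = \sum_(i < size s) nth 0 s i * u ^+ i.
Proof.
elim: s => [|a s IH] /=; first by rewrite big_ord0.
rewrite IH big_ord_recl /= expr0 mulr1 mulr_sumr; congr (_ + _).
by apply: eq_bigr => i _; rewrite exprS; ring.
Qed.

Lemma ival_sum s : ival s = \sum_(i < size s) (nth 0 s i)%:~R * u ^+ i.
Proof.
rewrite /ival hval_sum size_map; apply: eq_bigr => i _.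
by rewrite (nth_map 0).
Qed.

Fixpoint sadd s t :=
  match s, t with
  | [::], _ => t
  | _, [::] => s
  | a :: s', b :: t' => a + b :: sadd s' t'
  end.

Lemma ival_sadd s t : ival (sadd s t) = ival s + ival t.
Proof.
elim: s t => [|a s IH] [|b t] /=; rewrite ?addr0 ?add0r //.
by rewrite !ival_cons IH rmorphD /=; ring.
Qed.

Lemma ival_scale (c : int) s : ival [seq c * a | a <- s] = c%:~R * ival s.
Proof.
elim: s => [|a s IH] /=; first by rewrite mulr0.
by rewrite !ival_cons IH rmorphM /=; ring.
Qed.

(** The quantity that decreases in [normalize]; it also measures how much multiplication by [ival s]
    enlarges digits. *)
Definition norm1 s : nat := sumn [seq `|a|%N | a <- s].

Lemma norm1_sadd s t : (norm1 (sadd s t) <= norm1 s + norm1 t)%N.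
Proof.
rewrite /norm1; elim: s t => [|a s IH] [|b t] //=; first by lia.
by move: (IH t); lia.
Qed.

Lemma norm1_cat s t : norm1 (s ++ t) = (norm1 s + norm1 t)%N.
Proof. by rewrite /norm1 map_cat sumn_cat. Qed.

Lemma norm1_scale (c : int) s : norm1 [seq c * a | a <- s] = (`|c| * norm1 s)%N.
Proof. by rewrite /norm1; elim: s => [|a s /= ->] /=; [rewrite muln0|nia]. Qed.

Lemma norm1_nseq0 n : norm1 (nseq n 0) = 0%N.
Proof. by elim: n. Qed.

Definition bdd (B : nat) s := all (fun a : int => `|a| <= B)%N s.

Lemma bdd_cat B s t : bdd B (s ++ t) = bdd B s && bdd B t.
Proof. exact: all_cat. Qed.

Lemma bdd_nseq0 B n : bdd B (nseq n 0).
Proof. by rewrite /bdd all_nseq absz0 leq0n orbT. Qed.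

Lemma bddW B B' s : (B <= B')%N -> bdd B s -> bdd B' s.
Proof. by move=> le; apply: sub_all => a /leq_trans; apply. Qed.

Lemma bdd_sadd B B' s t : bdd B s -> bdd B' t -> bdd (B + B') (sadd s t).
Proof.
elim: s t => [|a s IH] [|b t] //=.
- by move=> _; apply: (@bddW B' _ (b :: t)); lia.
- by move=> + _; apply: (@bddW B _ (a :: s)); lia.
- by case/andP=> ha hs /andP[hb ht]; rewrite IH // andbT; lia.
Qed.

Lemma bdd_scale B (c : int) s :
  bdd B s -> bdd (`|c| * B) [seq c * a | a <- s].
Proof.
rewrite /bdd all_map; apply: sub_all => a /= ha.
by rewrite abszM leq_mul2l ha orbT.
Qed.

Lemma bdd_take B n s : bdd B s -> bdd B (take n s).
Proof. by rewrite -{1}(cat_take_drop n s) bdd_cat => /andP[]. Qed.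

Lemma bdd_drop B n s : bdd B s -> bdd B (drop n s).
Proof. by rewrite -{1}(cat_take_drop n s) bdd_cat => /andP[]. Qed.

Lemma bdd_nth B s i : bdd B s -> (`|nth 0%R s i| <= B)%N.
Proof.
move=> hs; have [lt|ge] := ltnP i (size s); last by rewrite nth_default.
by move/(all_nthP 0): hs; apply.
Qed.

(** Membership in the set [X_B]. *)
Definition digsum (B : nat) x := exists2 s, bdd B s & ival s = x.

Lemma digsumW B B' x : (B <= B')%N -> digsum B x -> digsum B' x.
Proof. by move=> le [s hs <-]; exists s => //; apply: bddW hs. Qed.

Lemma digsum0 B : digsum B 0.
Proof. by exists [::]. Qed.

Lemma digsumD B B' x y : digsum B x -> digsum B' y -> digsum (B + B') (x + y).
Proof.
move=> [s hs <-] [t ht <-]; exists (sadd s t); last exact: ival_sadd.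
exact: bdd_sadd.
Qed.

Lemma digsumZ B (c : int) x : digsum B x -> digsum (`|c| * B) (c%:~R * x).
Proof.
move=> [s hs <-]; exists [seq c * a | a <- s]; last exact: ival_scale.
exact: bdd_scale.
Qed.

Lemma digsumN B x : digsum B x -> digsum B (- x).
Proof. by move/(digsumZ (-1)); rewrite mul1n rmorphN mulN1r. Qed.

Lemma digsum_cons B (a : int) x :
  (`|a| <= B)%N -> digsum B x -> digsum B (a%:~R + u * x).
Proof. by move=> ha [s hs <-]; exists (a :: s) => //=; rewrite ha. Qed.

Lemma digsum_mulXn B x k : digsum B x -> digsum B (u ^+ k * x).
Proof.
elim: k => [|k IH] hx; first by rewrite expr0 mul1r.
rewrite exprS -mulrA -[_ * _]add0r; apply: (@digsum_cons B 0) => //.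
exact: IH.
Qed.

(** Each digit of absolute value [B.+1] gives up one unit of its sign; this drives the induction on
    [B] in [digsum_shift]. *)
Lemma digsum_split B x : digsum B.+1 x ->
  exists y z, [/\ digsum B y, digsum 1 z & x = y + z].
Proof.
move=> [s hs <-{x}]; elim: s hs => [_|a s IH /= /andP[ha hs]].
  by exists 0, 0; split; [exact: digsum0 | exact: digsum0 | rewrite addr0].
have [y [z [hy hz e]]] := IH hs.
have [a1 [a2 [h1 h2 ->]]] : exists a1 a2 : int,
    [/\ (`|a1| <= B)%N, (`|a2| <= 1)%N & a = a1 + a2].
  case: (ltnP B `|a|) => hB; last by exists a, 0; split => //; lia.
  by exists (a - sgz a), (sgz a); split; lia.
exists (a1%:~R + u * y), (a2%:~R + u * z); split; try exact: digsum_cons.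
by rewrite ival_cons e rmorphD /=; ring.
Qed.

(** The product is a sum of shifts [a u^k x] over the digits [a] of [s], each adding at most [|a| B]
    to a digit. *)
Lemma digsum_mul s B x : digsum B x -> digsum (norm1 s * B) (ival s * x).
Proof.
move=> hx; elim: s => [|a s IH]; first by rewrite mul0r; apply: digsum0.
rewrite ival_cons mulrDl -mulrA [norm1 _]/= mulnDl; apply: digsumD; last first.
  by rewrite -[_ * _]add0r; apply: (@digsum_cons _ 0).
exact: digsumZ.
Qed.

End DigitSums.

(** * Lowering digits with a dominant relation *)

Section Normalize.
Variables (R : realType) (u : R).
Implicit Types (s t : seq int) (x y : R).

(* Wherever a digit is at least [E] in absolute value, subtracting a shifted
   copy of the relation lowers the sum of the absolute values of the digits. *)
Lemma normalize (E : nat) (e1 e2 : seq int) :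
  (norm1 e1 + norm1 e2 < E)%N -> ival u (e1 ++ E%:Z :: e2) = 0 ->
  forall s, exists m t, bdd E.-1 t /\ ival u t = u ^+ m * ival u s.
Proof.
move=> hE he s; have [n] := ubnP (norm1 s); elim: n s => // n IH s hn.
have [hs|] := boolP (bdd E.-1 s).
  by exists 0%N, s; split => //; rewrite mul1r.
rewrite -has_predC => /(has_nthP 0) [k hk]; rewrite /= -ltnNge => hka.
pose s1 := take k s; pose s2 := drop k.+1 s; pose a : int := s`_k.
have es : s = s1 ++ a :: s2 by rewrite /s1 /s2 /a -drop_nth // cat_take_drop.
have sz1 : size s1 = k by rewrite size_takel // ltnW.
have hE0 : (0 < E)%N by lia.
have ha : (E <= `|a|)%N by move: hka hE0; rewrite -/a; clear; lia.
clearbody a; pose g := sgz a.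
(* Shifting [s] up by [size e1] makes room for [e1] and aligns the dominant digit with [a]. That
   digit drops by [E] in absolute value, while the other terms add less than [E] in all. *)
pose s' := sadd (sadd (nseq (size e1) 0 ++ s1)
                      (nseq (size e1 + k) 0 ++ (a - g * E%:Z) :: s2))
                (nseq k 0 ++ [seq - g * b | b <- e1 ++ 0 :: e2]).
have hs' : (norm1 s' < n)%N.
  rewrite es norm1_cat /= in hn.
  have h1 := norm1_sadd (sadd (nseq (size e1) 0 ++ s1)
                      (nseq (size e1 + k) 0 ++ (a - g * E%:Z) :: s2))
                (nseq k 0 ++ [seq - g * b | b <- e1 ++ 0 :: e2]).
  have h2 := norm1_sadd (nseq (size e1) 0 ++ s1)
                      (nseq (size e1 + k) 0 ++ (a - g * E%:Z) :: s2).
  rewrite norm1_cat norm1_nseq0 norm1_scale norm1_cat in h1.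
  rewrite !norm1_cat !norm1_nseq0 in h2.
  rewrite -/s' in h1.
  have e1' : norm1 (0 :: e2) = norm1 e2 by [].
  have e2' b t : norm1 (b :: t) = (`|b| + norm1 t)%N by [].
  rewrite e1' in h1; rewrite !e2' in h2 hn.
  have hg : (`|(- g)%R| = 1)%N by move: ha hE0; rewrite /g; clear; lia.
  have hag : (`|(a - g * E%:Z)%R| + E = `|a|)%N.
    by move: ha hE0; rewrite /g; clear; nia.
  by rewrite hg in h1; lia.
have [m [t [ht e]]] := IH _ hs'.
exists (m + size e1)%N, t; split => //; rewrite e exprD -mulrA; congr (_ * _).
rewrite /s' !ival_sadd !ival_cat !ival_nseq0 !size_nseq !ival_scale !ival_cat.
rewrite !ival_cons es ival_cat ival_cons sz1 rmorphB rmorphN !rmorphM /=.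
rewrite ival_cat ival_cons in he.
rewrite !add0r -[RHS]subr0 -[X in _ = _ - X](mulr0 (g%:~R * u ^+ k)).
rewrite -[X in _ = _ - _ * X]he exprD.
ring.
Qed.

End Normalize.

(** * Escape of Horner values and growth of powers *)

Section Growth.
Variables (R : realType) (u : R).
Hypothesis u1 : 1 < u.
Implicit Types (s t : seq int) (x y : R).

(** [G / (u - 1)] is the fixed point of [r -> u r - G]: beyond it, multiplication by [u] outweighs
    any admissible digit. *)
Lemma horner_escape (G a r : R) : `|a| <= G -> G / (u - 1) < `|r| ->
  G / (u - 1) < `|a + u * r| /\ (0 < a + u * r) = (0 < r).
Proof.
move=> ha hr; have u0 : 0 < u - 1 by rewrite subr_gt0.
set C := G / (u - 1) in hr *.
have eG : G = C * (u - 1) by rewrite /C divfK // gt_eqF.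
have hC : 0 <= C by rewrite /C divr_ge0 ?(le_trans _ ha) // ltW.
have [r0|r0] := ltP 0 r.
  rewrite gtr0_norm // in hr.
  have h : C < a + u * r.
    have := ler_norml a G; rewrite ha => /esym/andP[h1 h2]; nra.
  by rewrite gtr0_norm (le_lt_trans hC h).
have h : a + u * r < - C.
  rewrite ler0_norm // in hr.
  have := ler_norml a G; rewrite ha => /esym/andP[h1 h2]; nra.
have h0 : a + u * r < 0 by lra.
by rewrite ltr0_norm //; split; [lra | apply/negbTE; rewrite -leNgt ltW].
Qed.

Lemma ival_escape B p s : bdd B s ->
  B%:R / (u - 1) < `|ival u (drop p s)| -> B%:R / (u - 1) < `|ival u s|.
Proof.
elim: p s => [|p IH] [|a s] //.
move=> /= /andP[ha hs] h; rewrite ival_cons.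
have [] // := @horner_escape B%:R a%:~R (ival u s); last exact: IH.
by rewrite -intr_norm -abszE -pmulrn ler_nat.
Qed.

Lemma ival_le B s :
  bdd B s -> `|ival u s| <= B%:R / (u - 1) * (u ^+ size s - 1).
Proof.
have u0 : u - 1 != 0 by rewrite subr_eq0 gt_eqF.
elim: s => [|a s IH] /=; first by rewrite normr0 expr0 subrr mulr0.
move=> /andP[ha hs]; rewrite ival_cons.
apply: le_trans (ler_normD _ _) _; rewrite normrM (gtr0_norm (lt_trans ltr01 u1)).
have -> : B%:R / (u - 1) * (u ^+ (size s).+1 - 1) =
  B%:R + u * (B%:R / (u - 1) * (u ^+ size s - 1)) by rewrite exprS; field.
apply: lerD; first by rewrite -intr_norm -abszE -pmulrn ler_nat.
by rewrite ler_wpM2l ?IH // ltW // (lt_trans ltr01).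
Qed.

Lemma expr_unbounded x : exists n : nat, x <= u ^+ n.
Proof.
(* Bernoulli's inequality. *)
have h (t : nat) : 1 + t%:R * (u - 1) <= u ^+ t.
  elim: t => [|t IH]; first by rewrite mul0r addr0 expr0.
  have t0 : 0 <= t%:R :> R by [].
  have := @ler_pM2l _ u; rewrite (lt_trans ltr01 u1) => /(_ isT) hm.
  rewrite -hm in IH; rewrite exprS -natr1; apply: le_trans IH.
  set v := u - 1 in hm *; have -> : u = 1 + v by rewrite /v; ring.
  have : 0 <= t%:R * v ^+ 2 by rewrite mulr_ge0 ?sqr_ge0.
  nra.
pose t := Num.bound `|x / (u - 1)|.
exists t; apply: le_trans (h t).
have v0 : 0 < u - 1 by rewrite subr_gt0.
have : x / (u - 1) < t%:R.
  exact: le_lt_trans (ler_norm _) (archi_boundP (normr_ge0 _)).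
rewrite ltr_pdivrMr //; lra.
Qed.

End Growth.

(** * The run of algorithm C on a digit sequence *)

Definition coef_fun (s : seq int) (j : int) : int :=
  if 0 <= j then nth 0 s `|j|%N else 0.

Lemma coef_fun_oversize (s : seq int) (j : int) : (size s)%:Z <= j -> coef_fun s j = 0.
Proof.
move=> hj; have hs : (size s <= `|j|)%N by lia.
by rewrite /coef_fun nth_default ?if_same.
Qed.

Section AlgorithmC.
Variables (R : realType) (u : R) (d : int -> int) (h : nat) (chat : R).
Hypothesis u1 : 1 < u.
Hypothesis d_supp : forall k : int, (k <= - (h%:Z)) \/ (0 < k) -> d k = 0.
Hypothesis d0 : d 0 = 1.
Hypothesis d_root : \sum_(i < h) (d (- (i%:Z)))%:~R * u ^ (- (i%:Z)) = 0.
Implicit Types (s : seq int) (a : int -> int) (p : nat).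

Definition window_val a (k : int) : R :=
  \sum_(i < h) u ^ (k - i%:Z) * (a (k - i%:Z))%:~R.

(* State of the algorithm on the digits [s] when the window consists of the
   positions [p, ..., p + h - 1]. *)
Definition run_inv s a p : Prop :=
  [/\ forall j, p%:Z + h%:Z - 1 < j -> a j = 0,
      forall j, j < p%:Z -> a j = coef_fun s j &
      window_val a (p%:Z + h%:Z - 1) = u ^+ p * ival u (drop p s)].

Lemma ival_drop s p : ival u (drop p s) = (nth 0 s p)%:~R + u * ival u (drop p.+1 s).
Proof.
have [lt|ge] := ltnP p (size s); first by rewrite (drop_nth 0 lt) ival_cons.
by rewrite !drop_oversize ?nth_default //; [rewrite /ival /=; ring | lia].
Qed.

(** Subtracting [a_k u^k p_3(u) = 0] keeps the value and, as [d 0 = 1], clears the top position. The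
    window then slides down and takes in position [p], which still holds its original digit. *)
Lemma run_inv_step s a p : run_inv s a p.+1 ->
  run_inv s (stepC d a (p%:Z + h%:Z)) p.
Proof.
have u0 : u != 0 by rewrite gt_eqF // (lt_trans ltr01).
have -> : p%:Z + h%:Z = p.+1%:Z + h%:Z - 1 by lia.
set k := p.+1%:Z + h%:Z - 1 => -[I1 I2 I3]; rewrite -/k in I1 I3.
have step_hi j : k < j -> stepC d a k j = 0.
  by move=> hj; rewrite /stepC I1 // d_supp; [ring | right; lia].
have step_k : stepC d a k k = 0 by rewrite /stepC subrr d0; ring.
have step_lo j : j <= p%:Z -> stepC d a k j = coef_fun s j.
  by move=> hj; rewrite /stepC I2 ?d_supp; [ring | left; lia | lia].
split.
- move=> j hj; have [->//|ne] := eqVneq j k; apply: step_hi; lia.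
- by move=> j hj; apply: step_lo; lia.
have ek : p%:Z + h%:Z - 1 = k - 1 by lia.
rewrite ek /window_val.
pose F (i : nat) := u ^ (k - i%:Z) * (stepC d a k (k - i%:Z))%:~R.
have -> : \sum_(i < h) u ^ (k - 1 - i%:Z) * (stepC d a k (k - 1 - i%:Z))%:~R =
          \sum_(i < h) F i.+1.
  by apply: eq_bigr => i _; rewrite /F; have -> : k - 1 - i%:Z = k - i.+1%:Z by lia.
(* The term [i = 0] is the cleared top position, so including it costs nothing; the last term is the
   incoming digit. *)
have hF : \sum_(i < h) F i.+1 = \sum_(i < h.+1) F i.
  by rewrite big_ord_recl /= {2}/F subr0 step_k; rewrite mulr0 add0r.
rewrite hF big_ord_recr /= {2}/F.
have ekp : k - h%:Z = p%:Z by lia.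
rewrite ekp step_lo // {1}/coef_fun /= -exprnP ival_drop.
have -> : \sum_(i < h) F i = window_val a k.
  rewrite /window_val -[RHS]subr0 -[X in _ = _ - X](mulr0 (u ^ k * (a k)%:~R)).
  rewrite -[X in _ = _ - _ * X]d_root mulr_sumr -sumrB; apply: eq_bigr => i _.
  rewrite /F /stepC rmorphB rmorphM /= expfzDr //.
  have -> : k - i%:Z - k = - i%:Z by lia.
  ring.
by rewrite I3 exprS; ring.
Qed.

(** The termination condition of C for a single run, with [B] in place of [3 |e_l|]. *)
Definition run_bound (B m fuel : nat) a (k : int) : Prop :=
  let res := runC d h chat m fuel a k in
  - (m%:Z) < res.2 ->
  (exists2 i : nat, (i < h)%N & chat < (`|res.1 (res.2 - i%:Z)|)%:~R) ->
  u ^ (res.2 - h%:Z) / (1 - u^-1) * B%:R < `|window_val res.1 res.2|.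

(** The run stops at once at an overflowing window. For [k = p + h - 1] the bound
    [u^(k-h) / (1 - u^-1) * B] is [u^p * (B / (u - 1))], so the digits from [p] upwards have already
    escaped. *)
Lemma run_escape B m s a p fuel :
  (0 < m)%N -> (0 < h)%N -> bdd B s -> run_inv s a p ->
  run_bound B m fuel a (p%:Z + h%:Z - 1) ->
  ~~ window_ok h chat a (p%:Z + h%:Z - 1) -> B%:R / (u - 1) < `|ival u s|.
Proof.
move=> m0 h0 hs [_ _ I3] hrun nok; apply: (@ival_escape _ _ u1 _ p) => //.
have u0 : 0 < u by rewrite (lt_trans ltr01).
have v0 : u - 1 != 0 by rewrite subr_eq0 gt_eqF.
have er : runC d h chat m fuel a (p%:Z + h%:Z - 1) = (a, p%:Z + h%:Z - 1).
  by case: fuel {hrun} => //= fuel; rewrite (negbTE nok) andbF.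
move: hrun; rewrite /run_bound er /= I3.
have -> : p%:Z + h%:Z - 1 - h%:Z = p%:Z - 1 by lia.
rewrite expfzDr ?gt_eqF // -exprnP exprN1 normrM gtr0_norm ?exprn_gt0 //.
have -> : u ^+ p / u / (1 - u^-1) * B%:R = u ^+ p * (B%:R / (u - 1)).
  by field; rewrite v0 gt_eqF.
rewrite ltr_pM2l ?exprn_gt0 //; apply; first by lia.
move: nok; rewrite /window_ok -has_predC => /hasP[i].
rewrite mem_iota add0n /= -ltNge => hi hc.
by exists i.
Qed.

(** An overflow would force an escape, against the bound on the value. So the window descends to the
    positions [0, ..., h - 1], where it carries the whole value. *)
Lemma run_window B m s a p fuel :
  (0 < m)%N -> (0 < h)%N -> (p <= fuel)%N -> bdd B s -> run_inv s a p ->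
  run_bound B m fuel a (p%:Z + h%:Z - 1) ->
  `|ival u s| <= B%:R / (u - 1) ->
  exists a', (forall i, (i < h)%N -> (`|a' (h%:Z - 1 - i%:Z)|)%:~R <= chat) /\
    ival u s = window_val a' (h%:Z - 1).
Proof.
move=> m0 h0 + hs; elim: p fuel a => [|p IH] fuel a hfuel inv hrun hval.
  have [wok|nok] := boolP (window_ok h chat a (0%:Z + h%:Z - 1)); last first.
    by have := run_escape m0 h0 hs inv hrun nok; rewrite ltNge hval.
  exists a; split.
    move=> i hi; move/allP: wok => /(_ i); rewrite mem_iota add0n => /(_ hi) /=.
    by rewrite add0r.
  by have [_ _] := inv; rewrite add0r drop0 expr0 mul1r.
have [wok|nok] := boolP (window_ok h chat a (p.+1%:Z + h%:Z - 1)); last first.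
  by have := run_escape m0 h0 hs inv hrun nok; rewrite ltNge hval.
case: fuel hfuel hrun => // fuel hfuel; rewrite /run_bound /= wok andbT.
have -> : - m%:Z < p.+1%:Z + h%:Z - 1 by lia.
have -> : p.+1%:Z + h%:Z - 1 = p%:Z + h%:Z by lia.
by move=> hrun; apply: IH hrun hval => //; apply: run_inv_step.
Qed.

End AlgorithmC.

(** * Finiteness of [X_B] in bounded intervals *)

Section Finiteness.
Variables (R : realType) (u : R).
Implicit Types (s t : seq int) (x y : R).

Definition fin_digsum (B : nat) (C : R) : Prop :=
  exists T : seq R, forall x, digsum u B x -> `|x| <= C -> x \in T.

Definition irange (B : nat) : seq int := [seq i%:Z - B%:Z | i <- iota 0 (B + B).+1].

Lemma mem_irange B (a : int) : (`|a| <= B)%N -> a \in irange B.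
Proof.
move=> ha; apply/mapP; exists `|(a + B%:Z)%R|%N; last by lia.
by rewrite mem_iota; lia.
Qed.

Definition hstep (B : nat) (T : seq R) : seq R :=
  [seq a%:~R + u * r | a <- irange B, r <- T].

Lemma mem_hstep B T (a : int) r :
  (`|a| <= B)%N -> r \in T -> a%:~R + u * r \in hstep B T.
Proof.
move=> ha hr; apply: (allpairs_f (fun (a : int) r => a%:~R + u * r)) => //.
exact: mem_irange.
Qed.

Lemma ival_size_finite B n :
  exists T : seq R, forall s, size s = n -> bdd B s -> ival u s \in T.
Proof.
elim: n => [|n [T hT]]; first by exists [:: 0] => -[|] //= _ _; rewrite mem_head.
exists (hstep B T) => -[] //= a s [hs] /andP[ha hb].
by rewrite ival_cons; apply: mem_hstep => //; apply: hT.
Qed.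

(** The final window consists of [h] integers bounded by [chat], so it has only finitely many
    possible values. *)
Lemma fin_digsum_of_run (d : int -> int) h chat B :
  1 < u -> (0 < h)%N ->
  (forall k : int, (k <= - (h%:Z)) \/ (0 < k) -> d k = 0) -> d 0 = 1 ->
  \sum_(i < h) (d (- (i%:Z)))%:~R * u ^ (- (i%:Z)) = 0 ->
  (forall s, bdd B s ->
     run_bound u d h chat B 1 (size s + h + 1) (coef_fun s)
       ((size s)%:Z + h%:Z)) ->
  fin_digsum B (B%:R / (u - 1)).
Proof.
move=> u1 h0 d_supp d0 d_root hrun.
have u0 : 0 < u by rewrite (lt_trans ltr01).
have [D hD] : exists D : nat, forall a : int, (`|a|)%:~R <= chat -> (`|a| <= D)%N.
  exists (Num.bound `|chat|) => a ha.
  rewrite -(ler_nat R); apply: le_trans (ltW (archi_boundP (normr_ge0 _))).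
  by apply: le_trans (ler_norm _); rewrite pmulrn abszE.
have [T hT] := ival_size_finite D h.
exists T => x [s hs <-] hx.
(* The starting window, at positions [size s + 1, ..., size s + h], lies above all digits, so its
   value is 0. *)
have inv : run_inv u h s (coef_fun s) (size s).+1.
  split => [j hj|//|]; first by rewrite coef_fun_oversize //; lia.
  rewrite drop_oversize ?leqnSn // mulr0 /window_val big1 // => i _.
  by rewrite coef_fun_oversize ?mulr0 //; have := ltn_ord i; lia.
have er : (size s).+1%:Z + h%:Z - 1 = (size s)%:Z + h%:Z by lia.
have := hrun s hs; rewrite -er => hr.
have [||a [ha ->]] := run_window u1 d_supp d0 d_root _ h0 _ hs inv hr hx; try lia.
pose t := mkseq (fun i => a i%:Z) h.
have -> : window_val u h a (h%:Z - 1) = ival u t.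
  rewrite ival_sum size_mkseq /window_val (reindex_inj rev_ord_inj) /=.
  apply: eq_bigr => i _; rewrite nth_mkseq //.
  have -> : h%:Z - 1 - (h - i.+1)%N%:Z = i by have := ltn_ord i; lia.
  by rewrite mulrC.
apply: hT; first by rewrite size_mkseq.
apply/(all_nthP 0) => i; rewrite size_mkseq => hi; rewrite nth_mkseq //.
apply: hD; have := ha (h - i.+1)%N.
have -> : h%:Z - 1 - (h - i.+1)%N%:Z = i by lia.
by apply; lia.
Qed.

Lemma fin_digsumW B B' C C' : (B <= B')%N -> C <= C' ->
  fin_digsum B' C' -> fin_digsum B C.
Proof.
move=> hB hC [T hT]; exists T => x hx hxC; apply: hT; last exact: le_trans hC.
exact: digsumW hx.
Qed.

(** Removing the lowest digit from [x = a + u r] leaves [|r| <= (|x| + B) / u <= C]. *)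
Lemma fin_digsum_step B C : 0 < u ->
  fin_digsum B C -> fin_digsum B (u * C - B%:R).
Proof.
move=> u0 [T hT].
exists (0 :: hstep B T) => x [[|a s] /=].
  by move=> _ <-; rewrite mem_head.
move=> /andP[ha hs] <-; rewrite ival_cons => hx.
rewrite in_cons; apply/orP; right.
apply: mem_hstep => //.
apply: hT; first by exists s.
rewrite -(ler_pM2l u0) -{1}(gtr0_norm u0) -normrM.
have haR : `|a%:~R : R| <= B%:R by rewrite -intr_norm -abszE -pmulrn ler_nat.
have := ler_normB (a%:~R + u * ival u s) a%:~R.
by rewrite addrAC subrr add0r; lra.
Qed.

(** [B / (u - 1)] is the fixed point of [C -> u C - B]. The larger [B'] supplies a start strictly
    above it, and each step multiplies the excess by [u]. *)
Lemma fin_digsum_unbounded B B' : 1 < u -> (B < B')%N ->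
  fin_digsum B' (B'%:R / (u - 1)) -> forall C, fin_digsum B C.
Proof.
move=> u1 hB hfin C; have u0 : 0 < u by rewrite (lt_trans ltr01).
have v0 : 0 < u - 1 by rewrite subr_gt0.
have vn : u - 1 != 0 by rewrite gt_eqF.
pose D : R := (B' - B)%:R / (u - 1).
have D0 : 0 < D by rewrite divr_gt0 // ltr0n subn_gt0.
have h (t : nat) : fin_digsum B (B%:R / (u - 1) + u ^+ t * D).
  elim: t => [|t IH].
    have -> : B%:R / (u - 1) + u ^+ 0 * D = B'%:R / (u - 1).
      by rewrite /D natrB 1?ltnW // expr0; field.
    exact: fin_digsumW (ltnW hB) (lexx _) hfin.
  have -> : B%:R / (u - 1) + u ^+ t.+1 * D =
      u * (B%:R / (u - 1) + u ^+ t * D) - B%:R by rewrite exprS; field.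
  exact: fin_digsum_step.
have [t ht] := expr_unbounded u1 (C / D).
apply: fin_digsumW (leqnn _) _ (h t).
move: ht; rewrite ler_pdivrMr // => ht; apply: le_trans ht _.
by rewrite lerDr divr_ge0 // ltW.
Qed.

End Finiteness.

(** * Passing to arbitrary digit bounds *)

Section AllDigitBounds.
Variables (R : realType) (u : R) (D B0 : nat).
Hypothesis u1 : 1 < u.
Hypothesis normD :
  forall s, exists m t, bdd D t /\ ival u t = u ^+ m * ival u s.
Hypothesis fin0 : fin_digsum u B0 (B0%:R / (u - 1)).
Hypotheses (leDB : (3 * D <= B0)%N) (ltDB : (D < B0)%N).
Implicit Types (s t : seq int) (x y : R).

Let u_gt0 : 0 < u. Proof. exact: lt_trans u1. Qed.

Lemma digit_bound_gt0 : (0 < D)%N.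
Proof.
rewrite lt0n; apply/eqP => D0.
have [m [t [ht]]] := normD [:: 1].
have := ival_le u1 ht; rewrite D0 !mul0r normr_le0 => /eqP ->.
rewrite ival_cons mulr0 addr0 mulr1 => /esym/eqP.
by rewrite expf_eq0 gt_eqF // andbF.
Qed.

(** A representation by digits at positions [-K, ..., -1] only. *)
Definition frac_rep (K : nat) x : Prop :=
  exists t, [/\ size t = K, bdd D t & ival u t = u ^+ K * x].

Lemma frac_repW K K' x : (K <= K')%N -> frac_rep K x -> frac_rep K' x.
Proof.
move=> le [t [szt ht et]]; exists (nseq (K' - K) 0 ++ t); split.
- by rewrite size_cat size_nseq szt subnK.
- by rewrite bdd_cat bdd_nseq0.
by rewrite ival_cat ival_nseq0 size_nseq add0r et mulrA -exprD subnK.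
Qed.

(** Short representations can be padded, so the maximal length over the finite list works; members
    with no representation are skipped. *)
Lemma frac_rep_uniform (T : seq R) :
  exists K, forall x, x \in T -> (exists K', frac_rep K' x) -> frac_rep K x.
Proof.
elim: T => [|y T [K hK]]; first by exists 0%N.
have [[K' hK']|nrep] := pselect (exists K', frac_rep K' y); last first.
  exists K => x; rewrite in_cons => /orP[/eqP -> //|]; exact: hK.
exists (maxn K K') => x; rewrite in_cons => /orP[/eqP -> _|hx /(hK _ hx)].
  exact: frac_repW (leq_maxr _ _) hK'.
exact: frac_repW (leq_maxl _ _).
Qed.

(* If [z] represents [x + y], the part of [x + y - z] at positions [>= 0] lies
   in a fixed finite set, since it equals the fractional part of [z]; so the
   fractional part of [z] may be replaced by one of bounded length. *)
Lemma digsum_add_shift :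
  exists K, forall x y, digsum u D x -> digsum u D y -> digsum u D (u ^+ K * (x + y)).
Proof.
have [T hT] := fin0; have [K hK] := frac_rep_uniform T; exists K => x y hx hy.
have [s _ es] := digsumD hx hy; rewrite -es.
have [m [t [ht et]]] := normD s.
(* The padding makes [t'] at least [m] long, so that cutting at [m] isolates exactly the positions
   below 0. *)
pose t' := t ++ nseq m 0.
have et' : ival u t' = u ^+ m * ival u s by rewrite ival_cat ival_nseq0 mulr0 addr0.
have ht' : bdd D t' by rewrite bdd_cat ht bdd_nseq0.
have szt : size (take m t') = m.
  by rewrite size_takel // size_cat size_nseq leq_addl.
pose r := ival u s - ival u (drop m t').
have er : ival u (take m t') = u ^+ m * r.
  rewrite mulrBr -et' -{2}(cat_take_drop m t') ival_cat szt; ring.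
have um0 : 0 < u ^+ m by rewrite exprn_gt0.
have [t2 [szt2 ht2 et2]] : frac_rep K r.
  apply: hK; last by exists m, (take m t'); split => //; apply: bdd_take.
  apply: hT.
    (* Two copies of [D] come from [x] and [y], the third from the integral part of [z]. *)
    apply: (digsumW leDB); rewrite (_ : (3 * D = D + D + D)%N); last by lia.
    apply: digsumD; first by rewrite es; apply: digsumD.
    by apply: digsumN; exists (drop m t') => //; apply: bdd_drop.
  (* [r] equals the fractional part of [z], which a geometric sum bounds by [D / (u - 1)]. *)
  rewrite -(ler_pM2l um0) -{1}(gtr0_norm um0) -normrM -er.
  apply: le_trans (ival_le u1 (bdd_take m ht')) _.
  have v0 : 0 < u - 1 by rewrite subr_gt0.
  rewrite szt mulrC ler_pM ?subr_ge0 ?exprn_ege1 ?(ltW u1) ?divr_ge0 ?(ltW v0) //.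
    by rewrite lerBlDr lerDl.
  by rewrite ler_pM2r ?invr_gt0 // ler_nat; apply: ltnW.
exists (t2 ++ drop m t'); first by rewrite bdd_cat ht2 bdd_drop.
by rewrite ival_cat szt2 et2 /r; ring.
Qed.

(** Layers with digits in [{-1, 0, 1}] are peeled off one at a time; each costs one use of
    [digsum_add_shift]. *)
Lemma digsum_shift B :
  exists K, forall x, digsum u B x -> digsum u D (u ^+ K * x).
Proof.
have [K1 hK1] := digsum_add_shift.
elim: B => [|B [K hK]].
  exists 0%N => x hx; rewrite mul1r; exact: digsumW hx.
exists (K1 + K)%N => x hx; have [y [z [hy hz ->]]] := digsum_split hx.
rewrite exprD -mulrA mulrDr; apply: hK1; first exact: hK.
apply: digsum_mulXn; apply: digsumW hz; exact: digit_bound_gt0.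
Qed.

(** Multiplication by [u^K] embeds [X_B] into [X_D], and [D < B0] makes [X_D] finite in every
    bounded interval. *)
Lemma fin_digsum_all B C : fin_digsum u B C.
Proof.
have [K hK] := digsum_shift B; have uK : 0 < u ^+ K by rewrite exprn_gt0.
have [T hT] := fin_digsum_unbounded u1 ltDB fin0 (u ^+ K * C).
exists [seq x / u ^+ K | x <- T] => x hx hxC; apply/mapP.
exists (u ^+ K * x); last by rewrite mulrC mulKf // gt_eqF.
by apply: hT; [exact: hK | rewrite normrM gtr0_norm // ler_pM2l].
Qed.

End AllDigitBounds.

(** * The ring [Z[u, 1/u]] and its action on the sets [X_B] *)

Section LaurentRing.
Variables (R : realType) (u : R).
Hypothesis u1 : 1 < u.
Implicit Types (s t : seq int) (x y : R).

Let u_gt0 : 0 < u. Proof. exact: lt_trans u1. Qed.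

(* Membership in [Z[u, 1/u]]. *)
Definition laurent x := exists m s, u ^+ m * x = ival u s.

Lemma ival_shift m s : u ^+ m * ival u s = ival u (nseq m 0 ++ s).
Proof. by rewrite ival_cat ival_nseq0 size_nseq add0r. Qed.

Lemma ival_mul s t : exists r, ival u s * ival u t = ival u r.
Proof.
elim: s => [|a s [r er]]; first by exists [::]; rewrite mul0r.
exists (sadd [seq a * b | b <- t] (0 :: r)).
by rewrite ival_sadd ival_scale !ival_cons -er mulr0z; ring.
Qed.

Lemma laurentM x y : laurent x -> laurent y -> laurent (x * y).
Proof.
move=> [m [s es]] [n [t et]]; have [r er] := ival_mul s t.
by exists (m + n)%N, r; rewrite -er -es -et exprD; ring.
Qed.

Lemma laurentD x y : laurent x -> laurent y -> laurent (x + y).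
Proof.
move=> [m [s es]] [n [t et]].
exists (m + n)%N, (sadd (nseq n 0 ++ s) (nseq m 0 ++ t)).
by rewrite ival_sadd -!ival_shift -es -et exprD; ring.
Qed.

Lemma laurent_int (a : int) : laurent a%:~R.
Proof. by exists 0%N, [:: a]; rewrite ival_cons mulr0 addr0 mul1r. Qed.

Lemma laurentN x : laurent x -> laurent (- x).
Proof.
by move=> hx; rewrite -mulN1r; apply: laurentM => //; apply: (laurent_int (-1)).
Qed.

Lemma laurentV m : laurent (u ^- m).
Proof.
exists m, [:: 1]; rewrite ival_cons mulr0 addr0 divff //.
by rewrite expf_eq0 gt_eqF // andbF.
Qed.

(** Integer multiples of [u^-m] are spaced more closely than [y - x] once [u^m >= 2 / (y - x)]. *)
Lemma laurent_dense x y : x < y -> exists z, laurent z /\ x < z /\ z < y.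
Proof.
move=> xy; have yx : 0 < y - x by rewrite subr_gt0.
have [m hm] := expr_unbounded u1 (2 / (y - x)).
have um : 0 < u ^+ m by rewrite exprn_gt0.
pose n := Num.floor (x * u ^+ m) + 1.
exists (n%:~R * u ^- m); split.
  by apply: laurentM (laurent_int _) (laurentV _).
rewrite ltr_pdivlMr // ltr_pdivrMr // /n rmorphD /=.
have h1 := floorD1_gt (x * u ^+ m).
have h2 := floor_le (x * u ^+ m).
rewrite rmorphD /= in h1.
move: hm; rewrite ler_pdivrMr // => hm; split => //.
nra.
Qed.

Lemma laurent_digsum B x : laurent x ->
  exists K B', forall y, digsum u B y -> digsum u B' (u ^+ K * (x * y)).
Proof.
move=> [m [s es]]; exists m, (norm1 s * B)%N => y hy.
by rewrite mulrA es; apply: digsum_mul.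
Qed.

(** Multiplication by powers of [u] preserves each [X_B], so the shifts required by the single terms
    combine into a common one. *)
Lemma laurent_lin_digsum B n (alpha : nat -> R) :
  (forall i, laurent (alpha i)) ->
  exists K B', forall xs : nat -> R, (forall i, digsum u B (xs i)) ->
    digsum u B' (u ^+ K * \sum_(i < n) alpha i * xs i).
Proof.
move=> halpha; elim: n => [|n [K [B1 hK]]].
  by exists 0%N, 0%N => xs _; rewrite big_ord0 mulr0; apply: digsum0.
have [K' [B2 hK']] := laurent_digsum B (halpha n).
exists (K + K')%N, (B1 + B2)%N => xs hxs; rewrite big_ord_recr /= exprD mulrDr.
apply: digsumD; first by rewrite mulrAC mulrC; apply: digsum_mulXn; apply: hK.
by rewrite -mulrA; apply: digsum_mulXn; apply: hK'.
Qed.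

Lemma fin_laurent_lin B n (alpha : nat -> R) :
  (forall B' C, fin_digsum u B' C) -> (forall i, laurent (alpha i)) ->
  forall C, exists T : seq R, forall xs : nat -> R, (forall i, digsum u B (xs i)) ->
    `|\sum_(i < n) alpha i * xs i| <= C -> \sum_(i < n) alpha i * xs i \in T.
Proof.
move=> hfin halpha C; have [K [B' hK]] := laurent_lin_digsum B n halpha.
have uK : 0 < u ^+ K by rewrite exprn_gt0.
have [T hT] := hfin B' (u ^+ K * C).
exists [seq x / u ^+ K | x <- T] => xs hxs hC; apply/mapP.
exists (u ^+ K * \sum_(i < n) alpha i * xs i); last first.
  by rewrite mulrC mulKf // gt_eqF.
by apply: hT; [exact: hK | rewrite normrM gtr0_norm // ler_pM2l].
Qed.

End LaurentRing.

(** * Closure properties of regular languages and Horner automata *)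

Section RegularLanguages.
Variable A : eqType.
Implicit Types (s : seq A) (L : seq A -> Prop).

Lemma regular_ext L L' : (forall s, L s <-> L' s) -> regular L -> regular L'.
Proof.
move=> e [Q [q0 [delta [F h]]]]; exists Q, q0, delta, F => s.
by rewrite -h; symmetry.
Qed.

Lemma regularI L L' :
  regular L -> regular L' -> regular (fun s => L s /\ L' s).
Proof.
move=> [Q [q0 [delta [F h]]]] [Q' [q0' [delta' [F' h']]]].
exists (Q * Q')%type, (q0, q0').
exists (fun q a => (delta q.1 a, delta' q.2 a)), (fun q => F q.1 && F' q.2) => s.
have -> : foldl (fun q a => (delta q.1 a, delta' q.2 a)) (q0, q0') s =
          (foldl delta q0 s, foldl delta' q0' s).
  by elim: s q0 q0' {h h'} => //= a s IH q q'; rewrite IH.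
by rewrite h h' /=; split=> [[-> ->]|/andP].
Qed.

Lemma regular_const (P : Prop) : regular (fun s : seq A => P).
Proof.
exists unit, tt, (fun _ _ => tt), (fun _ => `[< P >]) => s.
by split => [hP|/asboolP]; first apply/asboolP.
Qed.

Lemma regular_bigcap n (L : nat -> seq A -> Prop) :
  (forall i, regular (L i)) -> regular (fun s => forall i, (i < n)%N -> L i s).
Proof.
move=> hL; elim: n => [|n IH]; first exact: regular_ext (regular_const True).
apply: regular_ext (regularI IH (hL n)) => s; split => [[h1 h2] i|h].
  by rewrite ltnS leq_eqVlt => /orP[/eqP -> //|]; apply: h1.
by split => [i hi|]; apply: h; rewrite ltnS // ltnW.
Qed.

Lemma regular_all (p : pred A) : regular (fun s => all p s).
Proof.
exists bool, true, (fun q a => q && p a), id => s.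
have -> : foldl (fun q a => q && p a) true s = all p s; last by [].
rewrite -[RHS]andTb; elim: s true => [|a s IH] b /=; first by rewrite andbT.
by rewrite IH andbA.
Qed.

Lemma regular_last (p : pred A) a0 : regular (fun s => p (last a0 s)).
Proof.
exists bool, (p a0), (fun _ a => p a), id => s.
by have -> : foldl (fun _ a => p a) (p a0) s = p (last a0 s) by elim: s a0 => /=.
Qed.

(* The automaton reading [s] from its end is simulated by storing, for every
   state [q], whether a run entering the part read so far in [q] accepts. *)
Lemma regular_foldr (Q : finType) (q0 : Q) (delta : A -> Q -> Q) (F : pred Q) :
  regular (fun s => F (foldr delta q0 s)).
Proof.
pose step (g : {ffun Q -> bool}) a : {ffun Q -> bool} := [ffun q => g (delta a q)].
exists {ffun Q -> bool}, [ffun q => F q], step, (fun g : {ffun Q -> bool} => g q0).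
move=> s; have h g : foldl step g s q0 = g (foldr delta q0 s).
  by elim: s g => //= a s IH g; rewrite IH ffunE.
by rewrite h ffunE.
Qed.

Lemma regular_head (p : pred A) a0 : regular (fun s => p (head a0 s)).
Proof.
apply: regular_ext (regular_foldr (p a0) (fun a _ => p a) id) => s.
by case: s.
Qed.

End RegularLanguages.

Lemma regular_preim (A A' : eqType) (f : A -> A') (L : seq A' -> Prop) :
  regular L -> regular (fun s => L (map f s)).
Proof.
move=> [Q [q0 [delta [F h]]]]; exists Q, q0, (fun q a => delta q (f a)), F => s.
rewrite h; have -> // : foldl delta q0 (map f s) =
    foldl (fun q a => delta q (f a)) q0 s.
by elim: s q0 {h} => /=.
Qed.

(** A state is either the exact value, as an element of [T], or the final sign after an escape. The
    sign is enough, since on nonzero arguments [P] depends only on it. *)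
Lemma regular_hval (R : realType) (u : R) (A : eqType) (g : A -> R) (G : R)
    (T : seq R) (P : pred R) :
  1 < u -> 0 <= G -> (forall a, `|g a| <= G) ->
  (forall s, `|hval u (map g s)| <= G / (u - 1) -> hval u (map g s) \in T) ->
  (forall x y, x != 0 -> y != 0 -> (0 < x) = (0 < y) -> P x = P y) ->
  regular (fun s => P (hval u (map g s))).
Proof.
move=> u1 G0 hg hT hP.
have hT0 : 0 \in T.
  by apply: (hT [::]); rewrite normr0 divr_ge0 // subr_ge0 ltW.
pose z : seq_sub T := SeqSub hT0.
pose delta a (q : seq_sub T + bool) : (seq_sub T + bool)%type :=
  match q with
  | inl t => let v := g a + u * val t in
             if insub v is Some t' then inl t' else inr (0 < v)
  | inr b => inr b
  end.
pose F (q : seq_sub T + bool) :=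
  match q with inl t => P (val t) | inr b => P (if b then 1 else -1) end.
apply: regular_ext (regular_foldr (inl z) delta F) => s.
suff h : match foldr delta (inl z) s with
         | inl t => val t = hval u (map g s)
         | inr b => G / (u - 1) < `|hval u (map g s)| /\ b = (0 < hval u (map g s))
         end.
  case: (foldr delta (inl z) s) h => [t <- //|b [h hb]] /=.
  suff -> : P (if b then 1 else -1) = P (hval u (map g s)) by [].
  apply: hP.
  - by case: b {hb}; rewrite ?oppr_eq0 oner_neq0.
  - rewrite -normr_gt0; apply: le_lt_trans h.
    by rewrite divr_ge0 // subr_ge0 ltW.
  by rewrite -hb; case: b {hb}; rewrite ?ltr01 // oppr_gt0 ltr10.
elim: s => [//|a s] /=; case: (foldr delta (inl z) s) => [t et|b [h hb]] /=.
  (* A value missing from [T] lies outside the interval, so its sign is final. *)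
  rewrite et; case: insubP => [t' _ -> //|hn]; split => //.
  by rewrite ltNge; apply: contra hn; apply: (hT (a :: s)).
by have [h1 h2] := horner_escape u1 (hg a) h; rewrite h1 h2.
Qed.

Lemma map_iota_eq (T : Type) (x0 : T) (f : nat -> T) m n (s : seq T) :
  size s = n -> (forall k, (k < n)%N -> f (m + k)%N = nth x0 s k) ->
  [seq f i | i <- iota m n] = s.
Proof.
move=> hs hf; apply: (@eq_from_nth _ x0); rewrite size_map size_iota ?hs // => k hk.
by rewrite (nth_map 0%N) ?size_iota // nth_iota // hf.
Qed.

Lemma bigmax_attained (T : eqType) (f : T -> nat) (s : seq T) :
  s != [::] -> exists2 x, x \in s & f x = \max_(y <- s) f y.
Proof.
elim: s => // x s IH _; rewrite big_cons.
have [->|s0] := eqVneq s [::].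
  by exists x; rewrite ?mem_head // big_nil maxn0.
have [y ys hy] := IH s0; rewrite -hy.
have [le|lt] := leqP (f x) (f y).
  by exists y; rewrite // in_cons ys orbT.
by exists x; rewrite ?mem_head.
Qed.

(** * Recognising the track of a single word *)

Section Tracks.
Variable E : nat.
Implicit Types (w : word) (r : seq int).

Definition blank : option int * bool := (None, false).
Definition inner (a : int) : option int * bool := (Some a, false).

(** The five blocks are padding, digits below position 0, the flagged digit at 0, digits above it,
    and padding. *)
Definition track_of (i : nat) (s1 : seq int) (a : int) (s2 : seq int) (j : nat) :
    seq (option int * bool) :=
  nseq i blank ++ map inner s1 ++ (Some a, true) :: map inner s2 ++ nseq j blank.

Definition small r := all (fun a : int => `|a| < E)%N r.

Definition is_track (s : seq (option int * bool)) : Prop :=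
  exists i s1 a s2 j, small (s1 ++ a :: s2) /\ s = track_of i s1 a s2 j.

(* [Some (seen, inside)]: has position 0 been read, is the last symbol a digit;
   [None] is the rejecting sink. *)
Definition track_step (q : option (bool * bool)) (l : option int * bool) :=
  if q is Some (seen, inside) then
    if [&& ~~ (seen && l.2), (if l.1 is Some a then `|a| < E else true)%N,
           l.2 ==> isSome l.1 &
           if seen then isSome l.1 ==> inside else inside ==> isSome l.1]
    then Some (seen || l.2, isSome l.1) else None
  else None.

Definition track_acc (q : option (bool * bool)) :=
  if q is Some (b, _) then b else false.

Lemma track_None s : foldl track_step None s = None.
Proof. by elim: s. Qed.

(** This lemma and the next three treat in turn the states after the word, inside it past 0, inside
    it before 0, and before the word. *)
Lemma track_acc_post s : track_acc (foldl track_step (Some (true, false)) s) ->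
  exists j, s = nseq j blank.
Proof.
elim: s => [|[[a|] [|]] s IH] /=; rewrite ?track_None //.
- by exists 0%N.
- by rewrite andbF track_None.
- by move=> /IH[j ->]; exists j.+1.
Qed.

Lemma track_acc_right s : track_acc (foldl track_step (Some (true, true)) s) ->
  exists s2 j, small s2 /\ s = map inner s2 ++ nseq j blank.
Proof.
elim: s => [|[[a|] [|]] s IH] /=; rewrite ?track_None //.
- by exists [::], 0%N.
- rewrite andbT; case: ifP => [ha /IH[s2 [j [h ->]]]|_];
    last by rewrite track_None.
  by exists (a :: s2), j; rewrite /= ha.
- by move=> /track_acc_post[j ->]; exists [::], j.+1.
Qed.

Lemma track_acc_left s : track_acc (foldl track_step (Some (false, true)) s) ->
  exists s1 a s2 j, small (s1 ++ a :: s2) /\ s = track_of 0 s1 a s2 j.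
Proof.
elim: s => [|[[a|] [|]] s IH] /=; rewrite ?track_None //.
- rewrite andbT; case: ifP => [ha /track_acc_right[s2 [j [h ->]]]|_];
    last by rewrite track_None.
  by exists [::], a, s2, j; rewrite /= ha.
- rewrite andbT; case: ifP => [ha /IH[s1 [a' [s2 [j [h ->]]]]]|_];
    last by rewrite track_None.
  by exists (a :: s1), a', s2, j; rewrite /= ha.
Qed.

Lemma track_acc_pre s :
  track_acc (foldl track_step (Some (false, false)) s) -> is_track s.
Proof.
elim: s => [|[[a|] [|]] s IH] /=; rewrite ?track_None //.
- rewrite andbT; case: ifP => [ha /track_acc_right[s2 [j [h ->]]]|_];
    last by rewrite track_None.
  by exists 0%N, [::], a, s2, j; rewrite /= ha.
- rewrite andbT; case: ifP => [ha /track_acc_left[s1 [a' [s2 [j [h ->]]]]]|_];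
    last by rewrite track_None.
  by exists 0%N, (a :: s1), a', s2, j; rewrite /= ha.
- by move=> /IH[i [s1 [a [s2 [j [h ->]]]]]]; exists i.+1, s1, a, s2, j.
Qed.

Lemma regular_is_track : regular is_track.
Proof.
exists (option (bool * bool)), (Some (false, false)), track_step, track_acc => s.
split; last exact: track_acc_pre.
move=> [i [s1 [a [s2 [j [+ ->]]]]]]; rewrite /small all_cat.
move=> /andP[h1 /= /andP[ha h2]]; rewrite /track_of !foldl_cat.
have -> : foldl track_step (Some (false, false)) (nseq i blank) = Some (false, false).
  by elim: i => //= i ->.
have [q0 ->] : exists q, foldl track_step (Some (false, false)) (map inner s1) =
    Some (false, q).
  suff h q : exists q', foldl track_step (Some (false, q)) (map inner s1) =
      Some (false, q') by apply: h.
  elim: s1 h1 q => [|b s1 IH] /= h1 q; first by exists q.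
  by have /andP[-> h1'] := h1; rewrite implybT; apply: IH.
have e : track_step (Some (false, q0)) (Some a, true) = Some (true, true).
  by rewrite /= ha implybT.
rewrite -cat1s foldl_cat [foldl _ _ [:: _]]e foldl_cat.
have -> : foldl track_step (Some (true, true)) (map inner s2) = Some (true, true).
  by elim: s2 h2 => //= b s2 IH /andP[hb h2]; rewrite hb IH.
suff : forall q, track_acc (foldl track_step (Some (true, q)) (nseq j blank)) by apply.
by elim: j => //= j IH q.
Qed.

Definition ptrack (M N : nat) w : seq (option int * bool) :=
  [seq (digit_at w (i%:Z - M%:Z), i%:Z - M%:Z == 0) | i <- iota 0 (M + N).+1].

Lemma ptrack_track_of i s1 a s2 j :
  ptrack (i + size s1) (size s2 + j) (size s1, s1 ++ a :: s2) = track_of i s1 a s2 j.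
Proof.
rewrite /ptrack.
have -> : (i + size s1 + (size s2 + j)).+1 = (i + (size s1 + (1 + (size s2 + j))))%N.
  by lia.
rewrite !iotaD !map_cat /track_of; congr (_ ++ _).
  apply: (map_iota_eq (x0 := blank)); first by rewrite size_nseq.
  move=> k hk; rewrite nth_nseq hk /blank; congr pair; last by apply/eqP; lia.
  by rewrite /digit_at /wlo /=; case: ifP => //; lia.
have hw : whi (size s1, s1 ++ a :: s2) = size s2.
  by rewrite /whi size_cat /=; lia.
congr (_ ++ _).
  apply: (map_iota_eq (x0 := inner 0)); first by rewrite size_map.
  move=> k hk; rewrite (nth_map 0) // /inner; congr pair; last by apply/eqP; lia.
  rewrite /digit_at hw /wlo /= ifT; last by lia.
  have -> : `|((0 + i + k)%N%:Z - (i + size s1)%N%:Z + (size s1)%:Z)%R|%N = k by lia.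
  by rewrite nth_cat hk.
rewrite /=; congr (_ :: _).
  congr pair; last by apply/eqP; lia.
  rewrite /digit_at hw /wlo /= ifT; last by lia.
  set p := absz _; have -> : p = size s1 by rewrite /p; lia.
  by rewrite nth_cat ltnn subnn.
congr (_ ++ _).
  apply: (map_iota_eq (x0 := inner 0)); first by rewrite size_map.
  move=> k hk; rewrite (nth_map 0) // /inner; congr pair; last by apply/eqP; lia.
  rewrite /digit_at hw /wlo /= ifT; last by lia.
  set p := absz _; have -> : p = (size s1 + k.+1)%N by rewrite /p; lia.
  by rewrite nth_cat ltnNge leq_addr /= addKn.
apply: (map_iota_eq (x0 := blank)); first by rewrite size_nseq.
move=> k hk; rewrite nth_nseq hk /blank; congr pair; last by apply/eqP; lia.
by rewrite /digit_at hw; case: ifP => //; lia.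
Qed.

Lemma inSP w : reflect
  (exists s1 a s2, small (s1 ++ a :: s2) /\ w = (size s1, s1 ++ a :: s2))
  (inS E%:Z w).
Proof.
have eS s : all (fun a : int => `|a| < E%:Z) s = small s.
  by apply: eq_all => a; lia.
rewrite /inS eS; apply: (iffP andP) => [[]|[s1 [a [s2 [h ->]]]]]; last first.
  by split=> //=; rewrite size_cat /=; lia.
case: w => m s /= hm hs; exists (take m s), (nth 0 s m), (drop m.+1 s).
by rewrite -drop_nth // cat_take_drop size_takel // ltnW.
Qed.

Lemma ptrack_is_track M N w :
  inS E%:Z w -> (wlo w <= M)%N -> (whi w <= N)%N -> is_track (ptrack M N w).
Proof.
case/inSP=> s1 [a [s2 [h ->]]]; rewrite /wlo /whi size_cat /= => hM hN.
exists (M - size s1)%N, s1, a, s2, (N - size s2)%N; split => //.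
rewrite -ptrack_track_of; congr ptrack; lia.
Qed.

(** The flag recovers both bounds: [M] letters precede it and [N] letters follow it. *)
Lemma is_track_ptrack s : is_track s ->
  exists w, [/\ inS E%:Z w, (wlo w <= index true (map snd s))%N,
    (whi w <= size s - (index true (map snd s)).+1)%N &
    s = ptrack (index true (map snd s)) (size s - (index true (map snd s)).+1) w].
Proof.
move=> [i [s1 [a [s2 [j [h ->]]]]]]; exists (size s1, s1 ++ a :: s2).
have -> : index true (map snd (track_of i s1 a s2 j)) = (i + size s1)%N.
  rewrite /track_of !map_cat !index_cat /= -!map_comp.
  have -> : (true \in map snd (nseq i blank)) = false.
    by rewrite map_nseq mem_nseq andbF.
  have -> : (true \in [seq (snd \o inner) x | x <- s1]) = false by apply/mapP => -[].
  by rewrite /= !size_map size_nseq addn0.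
have -> : (size (track_of i s1 a s2 j) - (i + size s1).+1 = size s2 + j)%N.
  by rewrite /track_of !size_cat /= size_cat !size_map !size_nseq; lia.
rewrite ptrack_track_of; split => //.
- by apply/inSP; exists s1, a, s2.
- exact: leq_addl.
- by rewrite /whi size_cat /=; lia.
Qed.

End Tracks.

(** * Recognising convolutions *)

Section Convolutions.
Variable E : nat.
Notation letter := (seq (option int) * bool)%type.
Implicit Types (w : word) (ws : seq word) (s : seq letter).

Definition track (t : nat) s : seq (option int * bool) :=
  [seq (nth None a.1 t, a.2) | a <- s].

Definition is_conv (r : nat) s : Prop :=
  exists ws, [/\ size ws = r, all (inS E%:Z) ws & s = conv ws].

Lemma track_conv ws t : (t < size ws)%N ->
  track t (conv ws) =
  ptrack (\max_(w <- ws) wlo w) (\max_(w <- ws) whi w) (nth (0%N, [::]) ws t).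
Proof.
move=> ht; rewrite /track /conv /ptrack -map_comp; apply: eq_map => i /=.
by rewrite (nth_map (0%N, [::])).
Qed.

Definition has_digit (a : letter) := has isSome a.1.

Notation l0 := (([::], false) : letter).

(** As [conv] takes the least possible [M] and [N], its first and last letters must each contain a
    digit. Otherwise the tracks can be checked separately, being aligned by the common flag. *)
Lemma is_convP r s : (0 < r)%N ->
  is_conv r s <->
  [/\ all (fun a : letter => size a.1 == r) s,
      forall t, (t < r)%N -> is_track E (track t s),
      has_digit (head l0 s) & has_digit (last l0 s)].
Proof.
move=> r0; split.
  move=> [ws [sz hws ->]]; set M := \max_(w <- ws) wlo w; set N := \max_(w <- ws) whi w.
  have ws0 : ws != [::] by rewrite -size_eq0 sz -lt0n.
  have hin w : w \in ws -> [/\ inS E%:Z w, (wlo w <= M)%N & (whi w <= N)%N].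
    move=> hw; split; first exact: (allP hws).
      by rewrite /M; apply: leq_bigmax_seq.
    by rewrite /N; apply: leq_bigmax_seq.
  split.
  - by apply/allP => a /mapP[i _ ->] /=; rewrite size_map sz.
  - move=> t ht; rewrite track_conv ?sz //.
    have [] := hin (nth (0%N, [::]) ws t); first by rewrite mem_nth ?sz.
    exact: ptrack_is_track.
  - have [w hw ew] := bigmax_attained wlo ws0.
    apply/hasP; exists (digit_at w (0%:Z - M%:Z)); last first.
      by rewrite /digit_at -/M ew -/M ifT //; lia.
    by rewrite /conv -/M -/N /=; apply: map_f.
  have [w hw ew] := bigmax_attained whi ws0.
  have -> : last l0 (conv ws) = ([seq digit_at w (N%:Z) | w <- ws], N%:Z == 0 :> int).
    rewrite /conv -/M -/N -addnS iotaD map_cat last_cat.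
    rewrite -[N.+1]addn1 iotaD map_cat last_cat /=.
    by have -> : (0 + M + N)%N%:Z - M%:Z = N by lia.
  apply/hasP; exists (digit_at w N%:Z); first exact: map_f.
  by rewrite /digit_at ew -/N ifT //; lia.
move=> [hsz htr hhd hlst].
set M := index true (map snd s); set N := (size s - M.+1)%N.
(* The condition [t < r] stands under the existential so that [choice] yields a total function. *)
have htrk t : exists w, (t < r)%N ->
    [/\ inS E%:Z w, (wlo w <= M)%N, (whi w <= N)%N & track t s = ptrack M N w].
  have [ht|ge] := ltnP t r; last by exists (0%N, [::]).
  have [w] := is_track_ptrack (htr t ht).
  have -> : map snd (track t s) = map snd s by rewrite /track -map_comp; apply: eq_map.
  by rewrite size_map -/M -/N => h; exists w.
have [f hf] := choice htrk.
have szs : size s = (M + N).+1.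
  have [_ _ _] := hf 0%N r0; move/(congr1 size).
  by rewrite /track /ptrack !size_map size_iota.
have hnth t i : (t < r)%N -> (i < size s)%N ->
    (nth None (nth l0 s i).1 t, (nth l0 s i).2) =
    (digit_at (f t) (i%:Z - M%:Z), i%:Z - M%:Z == 0 :> int).
  move=> ht hi; have [_ _ _ e] := hf t ht.
  have := congr1 (fun x => nth blank x i) e.
  rewrite /track /ptrack (nth_map l0) // (nth_map 0%N) ?size_iota -?szs //.
  by rewrite nth_iota -?szs.
have hsome i : (i < size s)%N -> has_digit (nth l0 s i) ->
    exists2 t, (t < r)%N & isSome (digit_at (f t) (i%:Z - M%:Z)).
  move=> hi /(has_nthP None)[t].
  move/all_nthP: hsz => /(_ l0 i hi) /eqP -> ht h; exists t => //.
  by have [<-] := hnth t i ht hi.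
pose ws := mkseq f r.
(* No word goes below [-M], and the digit in the first letter shows that some word reaches it; [eN]
   is symmetric. *)
have eM : \max_(w <- ws) wlo w = M.
  apply/eqP; rewrite eqn_leq; apply/andP; split.
    apply/bigmax_leqP_seq => w /mapP[t]; rewrite mem_iota add0n => ht -> _.
    by have [] := hf t ht.
  move: hhd; rewrite -nth0 => /(hsome 0%N); rewrite szs => /(_ isT)[t ht].
  rewrite /digit_at; case: ifP => // /andP[h _] _.
  apply: leq_trans (leq_bigmax_seq _ _ _) => //; last first.
    by apply/mapP; exists t; rewrite // mem_iota.
  lia.
have eN : \max_(w <- ws) whi w = N.
  apply/eqP; rewrite eqn_leq; apply/andP; split.
    apply/bigmax_leqP_seq => w /mapP[t]; rewrite mem_iota add0n => ht -> _.
    by have [] := hf t ht.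
  move: hlst; rewrite -nth_last => /(hsome (size s).-1).
  rewrite szs => /(_ (leqnn _))[t ht].
  rewrite /digit_at; case: ifP => // /andP[_ h] _.
  apply: leq_trans (leq_bigmax_seq _ _ _) => //; last first.
    by apply/mapP; exists t; rewrite // mem_iota.
  rewrite /= in h; lia.
exists ws; split.
- by rewrite size_mkseq.
- apply/allP => w /mapP[t]; rewrite mem_iota add0n => ht ->.
  by have [] := hf t ht.
apply: (@eq_from_nth _ l0).
  by rewrite /conv size_map size_iota eM eN.
move=> i hi; rewrite /conv eM eN (nth_map 0%N) ?size_iota -?szs //.
rewrite nth_iota -?szs // add0n.
have sza : size (nth l0 s i).1 = r.
  by move/all_nthP: hsz => /(_ l0 i hi) /eqP.
rewrite [LHS]surjective_pairing; congr pair; last by have [_ ->] := hnth 0%N i r0 hi.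
apply: (@eq_from_nth _ None); first by rewrite size_map size_mkseq.
move=> t; rewrite sza => ht; have [-> _] := hnth t i ht hi.
by rewrite (nth_map (0%N, [::])) ?size_mkseq // nth_mkseq.
Qed.

Lemma regular_is_conv r : (0 < r)%N -> regular (is_conv r).
Proof.
move=> r0.
have hT t : regular (fun s : seq letter => is_track E (track t s)).
  exact: regular_preim (regular_is_track E).
have h1 := regular_all (fun a : letter => size a.1 == r).
have h2 := regularI (regular_head has_digit l0) (regular_last has_digit l0).
apply: regular_ext (regularI (regularI h1 (regular_bigcap r hT)) h2) => s.
by rewrite is_convP //; split => [[[? ?] [? ?]]|[? ? ? ?]].
Qed.

End Convolutions.

(** * Automata for linear relations between words *)

Section LinearRelations.
Variables (R : realType) (u : R) (E : nat).
Hypothesis u1 : 1 < u.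
Implicit Types (w : word) (ws : seq word).
Notation letter := (seq (option int) * bool)%type.

Let u_gt0 : 0 < u. Proof. exact: lt_trans u1. Qed.

Lemma wval_ival w : u ^+ w.1 * wval u w = ival u w.2.
Proof.
rewrite /wval ival_sum mulr_sumr; apply: eq_bigr => i _.
rewrite expfzDr ?gt_eqF // mulrC -!mulrA; congr (_ * _).
by rewrite -exprnP -exprnN mulVf ?mulr1 // expf_eq0 gt_eqF // andbF.
Qed.

(* Large digits, which never occur in valid words, count as [0] to keep the
   weights of the letters bounded. *)
Definition digit_of (o : option int) : int :=
  if o is Some a then if (`|a| < E)%N then a else 0 else 0.

Lemma digit_of_le o : (`|digit_of o| <= E)%N.
Proof. by case: o => //= a; case: ifP => // /ltnW. Qed.

Lemma ival_ptrack M N w : inS E%:Z w -> (wlo w <= M)%N -> (whi w <= N)%N ->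
  ival u [seq digit_of p.1 | p <- ptrack M N w] = u ^+ M * wval u w.
Proof.
case/inSP=> s1 [a [s2 [h ->]]] hM hN; rewrite /wlo /whi size_cat /= in hM hN.
have -> : ptrack M N (size s1, s1 ++ a :: s2) =
    track_of (M - size s1) s1 a s2 (N - size s2).
  by rewrite -ptrack_track_of; congr ptrack; lia.
rewrite -(subnK hM) exprD addnK -mulrA (wval_ival (size s1, s1 ++ a :: s2)) /=.
move: h; rewrite /small all_cat => /andP[h1 /= /andP[ha h2]].
have e r : small E r -> [seq digit_of p.1 | p <- map inner r] = r.
  by rewrite -map_comp => /allP hr; apply: map_id_in => b /hr /= ->.
rewrite /track_of !map_cat /= map_cat !map_nseq /= ha !e //.
rewrite ival_cat ival_nseq0 add0r size_nseq; congr (_ * _).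
by rewrite !ival_cat !ival_cons ival_cat ival_nseq0 mulr0 addr0.
Qed.

Variables (r : nat) (alpha : nat -> R).

(** Linear combinations commute with Horner's rule, so a single evaluation with these weights
    handles all tracks. *)
Definition weight (a : letter) : R :=
  \sum_(t < r) alpha t * (digit_of (nth None a.1 t))%:~R.

Lemma hval_weight (s : seq letter) : hval u (map weight s) =
  \sum_(t < r) alpha t * ival u [seq digit_of p.1 | p <- track t s].
Proof.
elim: s => [|a s IH] /=; first by rewrite big1 // => t _; rewrite mulr0.
rewrite IH mulr_sumr -big_split; apply: eq_bigr => t _ /=.
by rewrite ival_cons; ring.
Qed.

Lemma hval_weight_conv ws : size ws = r -> all (inS E%:Z) ws ->
  hval u (map weight (conv ws)) = u ^+ (\max_(w <- ws) wlo w) *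
    \sum_(t < r) alpha t * wval u (nth (0%N, [::]) ws t).
Proof.
move=> sz hws; rewrite hval_weight mulr_sumr; apply: eq_bigr => t _.
have hin : nth (0%N, [::]) ws t \in ws by rewrite mem_nth ?sz.
rewrite track_conv ?sz // ival_ptrack; first by ring.
- exact: (allP hws).
- exact: leq_bigmax_seq.
- exact: leq_bigmax_seq.
Qed.

Lemma regular_linear_relation (P : pred R) : (0 < r)%N ->
  (forall B C, fin_digsum u B C) -> (forall t, laurent u (alpha t)) ->
  (forall x y, x != 0 -> y != 0 -> (0 < x) = (0 < y) -> P x = P y) ->
  regular (fun s => exists ws, [/\ size ws = r, all (inS E%:Z) ws,
    P (\sum_(t < r) alpha t * wval u (nth (0%N, [::]) ws t)) & s = conv ws]).
Proof.
move=> r0 hfin halpha hP.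
pose G := \sum_(t < r) `|alpha t| * E%:R.
have G0 : 0 <= G by apply: sumr_ge0 => t _; rewrite mulr_ge0.
have hG a : `|weight a| <= G.
  apply: le_trans (ler_norm_sum _ _ _) _; apply: ler_sum => t _.
  rewrite normrM ler_wpM2l // -intr_norm -abszE -pmulrn ler_nat.
  exact: digit_of_le.
have [T hT] := fin_laurent_lin u1 E r hfin halpha (G / (u - 1)).
have hreg : regular (fun s : seq letter => P (hval u (map weight s))).
  apply: (regular_hval u1 G0 hG (T := T)) => // s; rewrite hval_weight => hs.
  apply: (hT (fun t => ival u [seq digit_of p.1 | p <- track t s])) => // t.
  exists [seq digit_of p.1 | p <- track t s] => //.
  by apply/allP => b /mapP[p _ ->]; apply: digit_of_le.
apply: regular_ext (regularI (regular_is_conv E r0) hreg) => s.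
(* The Horner value carries the positive factor [u^M] coming from the lowest position [-M]; [P] does
   not see it. *)
have hPs k x : P (u ^+ k * x) = P x.
  have uk : 0 < u ^+ k by rewrite exprn_gt0.
  have [->|x0] := eqVneq x 0; first by rewrite mulr0.
  by apply: hP => //; [rewrite mulf_neq0 // gt_eqF | rewrite pmulr_rgt0].
split=> [[[ws [sz hws ->]]]|[ws [sz hws h ->]]].
  by rewrite hval_weight_conv // hPs => h; exists ws.
by split; [exists ws | rewrite hval_weight_conv // hPs].
Qed.

End LinearRelations.

(** * The operations and relations on [S] *)

Section Structure.
Variables (R : realType) (u : R) (E : nat).
Hypothesis u1 : 1 < u.
Hypothesis hfin : forall B C, fin_digsum u B C.
Hypothesis normE :
  forall s, exists m t, bdd E.-1 t /\ ival u t = u ^+ m * ival u s.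
Hypothesis E0 : (0 < E)%N.
Implicit Types (x y z : word).

Let u_gt0 : 0 < u. Proof. exact: lt_trans u1. Qed.

Lemma laurent_wval x : laurent u (wval u x).
Proof. by exists x.1, x.2; apply: wval_ival. Qed.

Lemma SvalP (v : R) : Sval E%:Z u v <-> laurent u v.
Proof.
split=> [[w [_ <-]]|[m [s es]]]; first exact: laurent_wval.
have [n [t [ht et]]] := normE s.
(* The digits start at position [-(n + m)]; the appended zeros make the domain contain position 0
   even when [t] is short. *)
exists ((n + m)%N, t ++ 0 :: nseq (n + m) 0); split.
  rewrite /inS /= size_cat /= size_nseq addnS ltnS leq_addl /= all_cat /= all_nseq.
  rewrite normr0 ltz_nat E0 orbT !andbT.
  apply: sub_all ht => a; rewrite -ltnS prednK // => ha; lia.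
have un : u ^+ (n + m) != 0 by rewrite expf_eq0 gt_eqF // andbF.
apply: (mulfI un); rewrite (wval_ival u1 (_, _)) /= ival_cat ival_cons ival_nseq0.
rewrite !(mulr0, addr0).
by rewrite et -es exprD mulrA.
Qed.

Let eq0_sign (v w : R) : v != 0 -> w != 0 -> (0 < v) = (0 < w) ->
  (v == 0) = (w == 0).
Proof. by move=> /negbTE -> /negbTE ->. Qed.

Let lt0_sign (v w : R) : v != 0 -> w != 0 -> (0 < v) = (0 < w) ->
  (v < 0) = (w < 0).
Proof. by case: ltgtP => // _ _; case: ltgtP. Qed.

Lemma laurent_nth (s : seq R) :
  (forall v, v \in s -> laurent u v) -> forall t, laurent u (nth 0 s t).
Proof.
move=> hs t; have [lt|ge] := ltnP t (size s); first exact: hs (mem_nth _ lt).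
by rewrite nth_default //; apply: (laurent_int u 0).
Qed.

Lemma regular_binary (c1 c2 : R) (P : pred R) :
  laurent u c1 -> laurent u c2 ->
  (forall v w, v != 0 -> w != 0 -> (0 < v) = (0 < w) -> P v = P w) ->
  regular (fun s => exists x y, [/\ inS E%:Z x, inS E%:Z y,
    P (c1 * wval u x + c2 * wval u y) & s = conv [:: x; y]]).
Proof.
move=> h1 h2 hP; have hc : forall t, laurent u (nth 0 [:: c1; c2] t).
  by apply: laurent_nth => v; rewrite !inE => /orP[] /eqP ->.
apply: regular_ext (regular_linear_relation E u1 (isT : 0 < 2)%N hfin hc hP) => s.
split=> [[ws [+ + + ->]]|[x [y [hx hy h ->]]]].
  case: ws => [|x [|y []]] //= _ /and3P[hx hy _].
  by rewrite !big_ord_recl big_ord0 addr0 => h; exists x, y.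
exists [:: x; y]; split => //=; first by rewrite hx hy.
by rewrite !big_ord_recl big_ord0 addr0.
Qed.

Lemma regular_ternary (c1 c2 c3 : R) (P : pred R) :
  laurent u c1 -> laurent u c2 -> laurent u c3 ->
  (forall v w, v != 0 -> w != 0 -> (0 < v) = (0 < w) -> P v = P w) ->
  regular (fun s => exists x y z, [/\ inS E%:Z x, inS E%:Z y, inS E%:Z z,
    P (c1 * wval u x + (c2 * wval u y + c3 * wval u z)) & s = conv [:: x; y; z]]).
Proof.
move=> h1 h2 h3 hP; have hc : forall t, laurent u (nth 0 [:: c1; c2; c3] t).
  by apply: laurent_nth => v; rewrite !inE => /or3P[] /eqP ->.
apply: regular_ext (regular_linear_relation E u1 (isT : 0 < 3)%N hfin hc hP) => s.
split=> [[ws [+ + + ->]]|[x [y [z [hx hy hz h ->]]]]].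
  case: ws => [|x [|y [|z []]]] //= _ /and4P[hx hy hz _].
  by rewrite !big_ord_recl big_ord0 addr0 => h; exists x, y, z.
exists [:: x; y; z]; split => //=; first by rewrite hx hy hz.
by rewrite !big_ord_recl big_ord0 addr0.
Qed.

Lemma automatic_add_digits : automatic_add E%:Z u.
Proof.
split=> [x y hx hy|].
  by apply/SvalP/laurentD; apply: laurent_wval.
have h1 := laurent_int u 1.
apply: regular_ext (regular_ternary h1 h1 (laurentN h1) eq0_sign) => s.
by split=> -[x [y [z [hx hy hz h ->]]]]; exists x, y, z; split => //;
  [apply/eqP; rewrite -subr_eq0 -(eqP h); apply/eqP | apply/eqP; rewrite -h]; ring.
Qed.

Lemma automatic_lt_digits : automatic_lt E%:Z u.
Proof.
have h1 := laurent_int u 1.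
apply: regular_ext (regular_binary h1 (laurentN h1) lt0_sign) => s.
split=> -[x [y [hx hy h ->]]]; exists x, y; split => //.
  by rewrite -subr_lt0; move: h; rewrite mulN1r mul1r.
by rewrite mulN1r mul1r subr_lt0.
Qed.

Lemma automatic_scale (c : R) : laurent u c ->
  regular (fun s => exists x y, [/\ inS E%:Z x, inS E%:Z y,
    c * wval u x = wval u y & s = conv [:: x; y]]).
Proof.
move=> hc; have hN := laurentN (laurent_int u 1).
apply: regular_ext (regular_binary hc hN eq0_sign) => s.
split=> -[x [y [hx hy h ->]]]; exists x, y; split => //.
  by apply/eqP; rewrite -subr_eq0; move: h; rewrite mulN1r.
by rewrite mulN1r h subrr.
Qed.

Lemma automatic_eq_digits : automatic_eq E%:Z u.
Proof.
apply: regular_ext (automatic_scale (laurent_int u 1)) => s.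
by split=> -[x [y [hx hy h ->]]]; exists x, y; split => //; move: h; rewrite mul1r.
Qed.

Lemma semiautomatic_mul_digits : semiautomatic_mul E%:Z u.
Proof.
split=> [x y hx hy|w hw].
  by apply/SvalP/laurentM; apply: laurent_wval.
have h := automatic_scale (laurent_wval w); split => //.
apply: regular_ext h => s.
by split=> -[x [y [hx hy h ->]]]; exists x, y; rewrite mulrC.
Qed.

Lemma dense_subring_digits : dense_subring (Sval E%:Z u).
Proof.
split.
- by apply/SvalP/(laurent_int u 1).
- by move=> v w /SvalP hv /SvalP hw; apply/SvalP/laurentD/laurentN.
- by move=> v w /SvalP hv /SvalP hw; apply/SvalP/laurentM.
move=> v w /(laurent_dense u1)[z [hz hvw]].
by exists z; split => //; apply/SvalP.
Qed.

(** [Dbc] quantifies over all subrings containing the generators, so it is instantiated with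
    [laurent u]. A power of [b] in the denominator is a power of [1 / b] or, for a negative
    exponent, the inverse of an integer power's inverse, hence an integer factor. *)
Lemma Dbc_laurent (b : nat) (c : R) :
  laurent u (1 / b%:R) -> laurent u c ->
  forall v, Dbc b c v -> laurent u v.
Proof.
move=> hb hc v; apply => //.
- exact: (laurent_int u 1).
- by move=> y z hy hz; apply: laurentD => //; apply: laurentN.
- by move=> y z; apply: laurentM.
move=> y [n [m ->]]; apply: laurentM; first exact: laurent_int.
have hX (x : R) : laurent u x -> forall k, laurent u (x ^+ k).
  move=> hx; elim=> [|k IH]; first exact: (laurent_int u 1).
  by rewrite exprS; apply: laurentM.
case: (intP m) => [|k|k].
- by rewrite expr0z invr1; apply: (laurent_int u 1).
- by rewrite -exprnP -exprVn -div1r; apply: hX.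
rewrite -exprnN invrK; apply: hX; rewrite pmulrn; exact: laurent_int.
Qed.

End Structure.

(** * From the given Laurent polynomials to the structure *)

Lemma leval_ival (R : realType) (u : R) f N : u != 0 ->
  u ^+ N * leval u f N = ival u (mkseq (fun i => f (i%:Z - N%:Z)) (N + N).+1).
Proof.
move=> u0; rewrite /leval ival_sum size_mkseq mulr_sumr; apply: eq_bigr => i _.
rewrite nth_mkseq // expfzDr // mulrC -!mulrA; congr (_ * _).
by rewrite -exprnP -exprnN mulVf ?mulr1 // expf_neq0.
Qed.

(** Dominance makes [e l] positive, so [l] lies within the support and the coefficient list can be
    cut there; the [norm1] of the two remaining pieces is [labs_others]. *)
Lemma dominant_split (R : realType) (u : R) e N l : u != 0 ->
  lsupp e N -> leval u e N = 0 -> labs_others e N l < e l ->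
  exists e1 e2, (norm1 e1 + norm1 e2 < `|e l|)%N /\
    ival u (e1 ++ `|e l|%N%:Z :: e2) = 0.
Proof.
move=> u0 hsupp he hl.
have oth0 : 0 <= labs_others e N l by apply: sumr_ge0 => i _.
have hlN : (`|l| <= N)%N.
  rewrite leqNgt; apply/negP => /hsupp el; move: hl; rewrite el; lia.
pose s := mkseq (fun i => e (i%:Z - N%:Z)) (N + N).+1.
pose k := `|(l + N%:Z)%R|%N.
have hk : (k < (N + N).+1)%N by rewrite /k; lia.
have ek : k%:Z - N%:Z = l by rewrite /k; lia.
have sk : nth 0 s k = e l by rewrite nth_mkseq // ek.
have eel : `|e l|%N%:Z = e l by lia.
have es : s = take k s ++ e l :: drop k.+1 s.
  by rewrite -sk -drop_nth ?size_mkseq // cat_take_drop.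
exists (take k s), (drop k.+1 s); rewrite eel -es; split; last first.
  by rewrite -leval_ival // he mulr0.
have en : (norm1 s)%:Z = `|e l| + labs_others e N l.
  rewrite /norm1 /s sumnE !big_map -[iota 0 _]/(index_iota 0 (N + N).+1) big_mkord.
  rewrite -natz natr_sum (bigD1 (Ordinal hk)) //= ek natz abszE; congr (_ + _).
  rewrite /labs_others; apply: eq_big => [i|i _]; last by rewrite natz abszE.
  congr negb; apply/eqP/eqP => [->//|h]; apply/val_inj => /=; lia.
have := norm1_cat (take k s) (e l :: drop k.+1 s); rewrite -es.
rewrite [norm1 (_ :: _)]/= -/(norm1 _) => en'.
move: en en'; rewrite /norm1 /=; lia.
Qed.

Theorem theorem2p1 (R : realType) (b : nat) (c u : R) (h : nat) (l : int)
  (chat : R) (N1 N2 N4 : nat) (bc cc d e : int -> int) :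
  (2 <= b)%N ->
  (exists j : nat, (0 < j)%N /\ exists z : int, c ^+ j = z%:~R) ->
  1 < u ->
  (1 <= h)%N ->
  (* p1 *)
  lsupp bc N1 -> leval u bc N1 = 1 / b%:R ->
  (* p2 *)
  lsupp cc N2 -> leval u cc N2 = c ->
  (* p3 = sum_{k=0,-1,...,-h+1} d_k x^k with d_0 = 1 *)
  (forall k : int, (k <= - (h%:Z)) \/ (0 < k) -> d k = 0) -> d 0 = 1 ->
  \sum_(i < h) (d (- (i%:Z)))%:~R * u ^ (- (i%:Z)) = 0 ->
  (* p4 *)
  lsupp e N4 -> leval u e N4 = 0 -> labs_others e N4 l < e l ->
  (* chat and algorithm C *)
  3%:R * (`|e l|)%:~R < chat ->
  (forall (m n : nat) (a : int -> int),
     (forall k : int, (k < - (m%:Z)) \/ (n%:Z < k) -> a k = 0) ->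
     (forall k : int, `|a k| <= 3 * `|e l|) ->
     let res := runC d h chat m (n + h + m) a (n%:Z + h%:Z) in
     let a' := res.1 in let k := res.2 in
     - (m%:Z) < k ->
     (exists2 i : nat, (i < h)%N & chat < (`|a' (k - i%:Z)|)%:~R) ->
     u ^ (k - h%:Z) / (1 - u^-1) * (3 * `|e l|)%:~R <
       `| \sum_(i < h) u ^ (k - i%:Z) * (a' (k - i%:Z))%:~R |) ->
  (forall x, Dbc b c x -> Sval `|e l| u x) /\
  automatic_add `|e l| u /\ automatic_lt `|e l| u /\ automatic_eq `|e l| u /\
  semiautomatic_mul `|e l| u /\
  dense_subring (Sval `|e l| u).
Proof.
move=> _ _ u1 h0 _ hp1 _ hp2 d_supp d0 d_root e_supp hp4 hdom _ hrun.
have u0 : u != 0 by rewrite gt_eqF // (lt_trans ltr01).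
have [e1 [e2 [hE he]]] := dominant_split u0 e_supp hp4 hdom.
rewrite -abszE in hrun *; move: hE he hrun; set E := `|e l|%N => hE he hrun.
have E0 : (0 < E)%N by lia.
have normE := normalize hE he.
have fin0 : fin_digsum u (3 * E) ((3 * E)%:R / (u - 1)).
  apply: (fin_digsum_of_run u1 h0 d_supp d0 d_root (chat := chat)) => s hs.
  (* With [m = 1] every window, even the last one with top [h - 1 >= 0], satisfies [k > -m]. *)
  have := hrun 1%N (size s) (coef_fun s).
  rewrite /run_bound /window_val; apply.
    move=> k [hk|hk]; last by rewrite coef_fun_oversize // ltW.
    by rewrite /coef_fun; case: ifP => //; lia.
  move=> k; rewrite /coef_fun; case: ifP => _ //.
  by have := bdd_nth `|k| hs; lia.
have hfin : forall B C, fin_digsum u B C.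
  (* Here [D = E.-1] and [B0 = 3 * E]; [0 < E] gives [D < B0]. *)
  move=> B C; apply: (fin_digsum_all u1 normE fin0); lia.
have hlev f N : laurent u (leval u f N) by do 2!eexists; apply: leval_ival.
split.
  move=> x hx; apply/(SvalP u1 normE E0); apply: Dbc_laurent hx.
    by rewrite -hp1.
  by rewrite -hp2.
split; first exact: automatic_add_digits.
split; first exact: automatic_lt_digits.
split; first exact: automatic_eq_digits.
split; first exact: semiautomatic_mul_digits.
exact: dense_subring_digits.
Qed.
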